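(* Let $d\ge 1$ and let $M\in\mathrm{Mat}(d,\mathbb{Z})$ be an arbitrary integer matrix, acting on the torus $\mathbb{T}^d=\mathbb{R}^d/\mathbb{Z}^d$ by $x\mapsto Mx \bmod 1$. For $m\ge 1$ let $a_m$ be the number of isolated fixed points of $M^m$ on $\mathbb{T}^d$, and let $\zeta_M(z)=\exp\bigl(\sum_{m=1}^{\infty}\frac{a_m}{m}z^m\bigr)$ be the associated Artin-Mazur zeta function. Then $$\zeta_M(z)=\prod_{k=0}^{d}\det\bigl(\mathbb{1}-\delta z\,{\textstyle\bigwedge^k}(M)\bigr)^{\varepsilon\,(-1)^{k+1}},$$ where the signs $\delta,\varepsilon\in\{1,-1\}$ are as follows. When neither $1$ nor $-1$ is an eigenvalue of $M$, $$\delta=\operatorname{sgn}\bigl(\det(\mathbb{1}+M)\bigr),\qquad \varepsilon=\delta\,\operatorname{sgn}\bigl(\det(\mathbb{1}-M)\bigr).$$ In general, writing $\det(x\mathbb{1}-M)=(x-1)^{\sigma}(x+1)^{\tau}Q(x)$ with integers $\sigma,\tau\ge 0$ and $Q\in\mathbb{Z}[x]$, $Q(1)\ne 0$, $Q(-1)\neq 0$, $$\delta=\operatorname{sgn}\left(\frac{\det(x\mathbb{1}+M)}{(x-1)^{\tau}}\bigg|_{x=1}\right),\qquad \varepsilon=\delta\,\operatorname{sgn}\left(\frac{\det(x\mathbb{1}-M)}{(x-1)^{\sigma}}\bigg|_{x=1}\right).$$ In particular, $\zeta_M(z)$ is a rational function. Moreover, when no eigenvalue of $M$ is a root of unity, all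 fixed points are covered this way, that is, for every $m\ge1$ all fixed points of $M^m$ on $\mathbb{T}^d$ are isolated, so that $a_m$ is the number of all fixed points of $M^m$.
   Context: $\mathbb{1}$ denotes the identity matrix of the appropriate size. For a $d\times d$ matrix $A$, $\bigwedge^k(A)$ is the induced linear map on the exterior power $\bigwedge^k(\mathbb{R}^d)$; in the standard basis it is the $\binom{d}{k}\times\binom{d}{k}$ matrix of all minors of $A$ of order $k$, with $\bigwedge^0(A)=1$, $\bigwedge^1(A)=A$, $\bigwedge^d(A)=\det(A)$. A fixed point of $M^m$ is isolated if it is an isolated point of the set of all fixed points of $M^m$ in $\mathbb{T}^d$. The exponential series defining $\zeta_M(z)$ is understood as a formal power series in $z$ (equivalently, as a convergent power series near $z=0$), and the identity says that it equals the power series expansion at $0$ of the stated rational function. The quotients in the definition of $\delta$ and $\varepsilon$ are polynomials in $x$, which are nonzero at $x=1$. *)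

(* Defs.v *)
From HB Require Import structures.
From mathcomp Require Import all_boot all_order all_algebra.
From mathcomp Require Import finmap.
From mathcomp Require Import all_classical all_reals all_analysis.
From mathcomp Require Import complex.

Set Implicit Arguments.
Unset Strict Implicit.
Unset Printing Implicit Defensive.

Import Order.TTheory GRing.Theory Num.Theory.
Import numFieldNormedType.Exports.

Local Open Scope classical_set_scope.
Local Open Scope ring_scope.
Local Open Scope quotient_scope.

Section Torus.
Variables (R : realType) (d : nat).

Definition lattice_rel (x y : 'cV[R]_d) : bool :=
  [forall i, x i ord0 - y i ord0 \is a Num.int].

Lemma lattice_rel_refl : reflexive lattice_rel.
Proof. by move=> x; apply/forallP => i; rewrite subrr rpred0. Qed.

Lemma lattice_rel_sym : symmetric lattice_rel.
Proof. by move=> x y; apply: eq_forallb => i; rewrite -rpredN opprB. Qed.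

Lemma lattice_rel_trans : transitive lattice_rel.
Proof.
move=> y x z /forallP xy /forallP yz; apply/forallP => i.
by rewrite -(subrKA (y i ord0)) rpredD.
Qed.

Canonical lattice_equiv :=
  EquivRel lattice_rel lattice_rel_refl lattice_rel_sym lattice_rel_trans.

Definition torus : Type := quotient_topology {eq_quot lattice_equiv}.

Definition torus_map (A : 'M[int]_d) (x : torus) : torus :=
  \pi_torus (map_mx intr A *m repr x).

Lemma torus_map_pi (A : 'M[int]_d) (x : 'cV[R]_d) :
  torus_map A (\pi_torus x) = \pi_torus (map_mx intr A *m x).
Proof.
have /forallP xr : lattice_rel (repr (\pi_torus x)) x.
  by apply/(@eqquotP _ lattice_equiv {eq_quot lattice_equiv}); exact: (@reprK _ torus).
apply/(@eqquotP _ lattice_equiv {eq_quot lattice_equiv})/forallP => i; rewrite !mxE -sumrB rpred_sum // => j _.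
by rewrite -mulrBr rpredM // mxE intr_int.
Qed.

Definition fixed_points (A : 'M[int]_d) : set torus :=
  [set x | torus_map A x = x].

(* [fset_set] of an infinite set is empty, so this count is meaningful only
   together with the finiteness of the set. *)
Definition num_isolated_fix (M : 'M[int]_d) (m : nat) : nat :=
  #|` fset_set (isolated (fixed_points (M ^+ m))) |.

End Torus.

Arguments fixed_points R [d] A.
Arguments num_isolated_fix R [d] M m.

(* Formal power series over the rationals are given by their coefficients
   [nat -> rat].  [fps_exp b] is exp (\sum_(m >= 1) b m z^m), [b 0] being
   ignored: its coefficient of z^n only involves the powers k <= n and the
   terms m <= n of the exponent, so that it can be computed on polynomials. *)
Definition fps_exp (b : nat -> rat) (n : nat) : rat :=
  (\sum_(k < n.+1)
     k`!%:R^-1 *: (\sum_(1 <= m < n.+1) b m *: 'X^m : {poly rat}) ^+ k)`_n.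

Definition zeta (R : realType) (d : nat) (M : 'M[int]_d) : nat -> rat :=
  fps_exp (fun m => (num_isolated_fix R M m)%:R / m%:R).

(* [f] is regular at 0 and its power series expansion there is [F]. *)
Definition expansion_at0 (f : {fraction {poly rat}}) (F : nat -> rat) : Prop :=
  exists p q : {poly rat},
    [/\ q.[0] != 0, f = tofrac p / tofrac q
      & forall n, \sum_(i < n.+1) q`_i * F (n - i)%N = p`_n].

Section ExteriorPower.
Variables (d k : nat).

(* The standard basis of the k-th exterior power is indexed by the strictly
   increasing k-tuples of indices. *)
Definition minor_index (i : 'I_('C(d, k))) : k.-tuple 'I_d :=
  enum_val (cast_ord (esym (card_ltn_sorted_tuples k d)) i).

Definition ext_power (K : comNzRingType) (A : 'M[K]_d) : 'M[K]_('C(d, k)) :=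
  \matrix_(i, j) \det (mxsub (tnth (minor_index i)) (tnth (minor_index j)) A).

End ExteriorPower.

Section RightHandSide.
Variables (d : nat) (M : 'M[int]_d).

(* det (1 - delta z /\^k M), a polynomial in z = 'X *)
Definition ext_factor (delta : int) (k : nat) : {poly rat} :=
  \det (1%:M - (delta%:~R * 'X) *: map_mx intr (ext_power k M)).

Definition zeta_ratfun (delta eps : int) : {fraction {poly rat}} :=
  \prod_(k < d.+1) tofrac (ext_factor delta k) ^ (eps * (-1) ^+ k.+1).

Definition pm1_factorization (sigma tau : nat) (Q : {poly int}) : Prop :=
  [/\ char_poly M = ('X - 1) ^+ sigma * ('X + 1) ^+ tau * Q,
      Q.[1] != 0 & Q.[-1] != 0].

(* The divisions are exact whenever [pm1_factorization sigma tau Q] holds. *)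
Definition delta_sign (tau : nat) : int :=
  Num.sg (\det ('X%:M + map_mx polyC M) %/ ('X - 1) ^+ tau).[1].

Definition eps_sign (sigma tau : nat) : int :=
  delta_sign tau *
  Num.sg (\det ('X%:M - map_mx polyC M) %/ ('X - 1) ^+ sigma).[1].

Definition complex_eigenvalue (R : realType) (x : R[i]) : bool :=
  eigenvalue (map_mx intr M : 'M[R[i]]_d) x.

End RightHandSide.

(* Main.v *)
Require Import Defs.
From HB Require Import structures.
From mathcomp Require Import all_boot all_order all_algebra all_field.
From mathcomp Require Import perm.
From mathcomp Require Import finmap.
From mathcomp Require Import all_classical all_reals all_analysis.
From mathcomp Require Import complex.
From mathcomp Require Import ring lra zify.

Set Implicit Arguments.
Unset Strict Implicit.
Unset Printing Implicit Defensive.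

Import Order.TTheory GRing.Theory Num.Theory.
Import numFieldNormedType.Exports.

Local Open Scope classical_set_scope.
Local Open Scope ring_scope.

(** Write [a_m] for the number of isolated fixed points of [M ^+ m].  Three
    independent facts give the theorem.

    Counting: [a_m = `|\det (1 - M ^+ m)|].  The class of [v] is fixed by [A]
    iff [(A - 1) v] is an integral vector.  If [A - 1] is nonsingular, its Smith
    normal form turns this into finitely many independent conditions
    [n_i * y_i \in Z] on the coordinates, with [\prod_i n_i = `|\det (A - 1)|]
    solutions in the torus ([fixed_points_finite_card]), all isolated since
    points are closed.  If [A - 1] is singular, each fixed point lies on a whole
    line of fixed points, so that none is isolated ([isolated_fixed_det0]).

    Signs: [`|\det (1 - M ^+ m)| = eps * delta ^+ m * \det (1 - M ^+ m)].
    Factor [M ^+ m - 1] as the product of the [M - z] over the [m]-th roots of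
    unity [z].  Nonreal roots come in conjugate pairs and contribute
    nonnegatively, so the sign is that of [\det (1 - M)], times that of
    [\det (1 + M)] when [m] is even ([det_1subX_sign]).  If one of these two
    determinants vanishes, the corresponding determinants
    [\det (1 - M ^+ m)] vanish too and no sign is needed; this is why a sign
    chosen through the multiplicities [sigma] and [tau] works in general.

    Traces: [\det (1 - A)] is the alternating sum of the traces of the exterior
    powers of [A] ([alt_sum_mxtrace_ext_power]; after triangularization this is
    the expansion of [\prod_i (1 - lambda_i)]), and exterior powers are
    multiplicative by the Cauchy-Binet formula, so that
    [a_m] is [eps * delta ^+ m] times the alternating sum of the traces of
    the [m]-th powers of the exterior powers of [M].

    The rational function then comes from logarithmic derivatives.  The series
    [\det (1 - z B)] has logarithmic derivative
    [- \sum_m \tr (B ^+ m.+1) z^m] ([logder_rev_char_poly]), and the zeta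
    function has logarithmic derivative [\sum_m a_(m+1) z^m].  If [p] and [q]
    are the products of the determinants with exponent [1] and [-1], the series
    [q * zeta] and [p] have the same logarithmic derivative and the same
    constant term, hence are equal ([expansion_zeta_ratfun]).

    Finally, [\det (M ^+ m - 1)] is also the product of the [\det (M - z)] over
    the complex [m]-th roots of unity [z], so it is nonzero as soon as no root of
    unity is an eigenvalue, and then all fixed points are isolated. *)

(** * Cauchy-Binet formula and traces of exterior powers *)

Section CauchyBinet.
Variable K : comNzRingType.

(** Each row of [A *m B] is a combination of the rows of [B]; expanding all of
    them by multilinearity gives one term for each choice [f] of a row of [B]
    in every position. *)
Lemma det_mulmx_ffun k d (A : 'M[K]_(k, d)) (B : 'M[K]_(d, k)) :
  \det (A *m B) =
  \sum_(f : {ffun 'I_k -> 'I_d}) (\prod_i A i (f i)) * \det (rowsub f B).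
Proof.
rewrite /determinant.
under eq_bigr => s _.
  rewrite (eq_bigr (fun i => \sum_j A i j * B j (s i))); last first.
    by move=> i _; rewrite mxE.
  rewrite bigA_distr_bigA big_distrr /=; over.
rewrite exchange_big /=; apply: eq_bigr => f _.
rewrite big_distrr /=; apply: eq_bigr => s _.
rewrite big_split /= mulrCA; congr (_ * (_ * _)).
by apply: eq_bigr => i _; rewrite mxE.
Qed.

(** In [det_mulmx_ffun] the choices [f] with a repeated row cancel; an injective
    [f] is uniquely a strictly increasing tuple [t] followed by a permutation
    [s], and summing over [s] rebuilds the minor of [A] on the columns [t]. *)
Lemma Cauchy_Binet k d (A : 'M[K]_(k, d)) (B : 'M[K]_(d, k)) :
  \det (A *m B) =
  \sum_(t : k.-tuple 'I_d | sorted ltn (map val t))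
     \det (colsub (tnth t) A) * \det (rowsub (tnth t) B).
Proof.
rewrite det_mulmx_ffun (bigID (fun f : {ffun 'I_k -> 'I_d} => injectiveb f)) /=.
rewrite [X in _ + X]big1 ?addr0; last first.
  move=> f /injectivePn[i [j ij fij]].
  by rewrite (determinant_alternate ij) ?mulr0 // => l; rewrite !mxE fij.
(* The increasing tuple attached to an arbitrary choice of rows. *)
pose srt (f : {ffun 'I_k -> 'I_d}) : k.-tuple 'I_d :=
  [tuple of sort (fun a b : 'I_d => (a <= b)%N) [tuple f i | i < k]].
have srt_perm (f : {ffun 'I_k -> 'I_d}) :
    perm_eq [tuple f i | i < k] (srt f).
  by rewrite perm_sym perm_sort.
rewrite (partition_big srt (fun t : k.-tuple 'I_d => sorted ltn (map val t))) /=; last first.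
  move=> f /injectiveP f_inj; rewrite ltn_sorted_uniq_leq map_inj_uniq; last exact: val_inj.
  rewrite sort_uniq map_inj_uniq ?enum_uniq //= sorted_map.
  by apply: sort_sorted => i j; apply: leq_total.
apply: eq_bigr => t t_sorted.
have t_uniq : uniq t.
  by rewrite -(map_inj_uniq val_inj); apply: (sorted_uniq ltn_trans ltnn).
have t_inj : injective (tnth t) by apply/tuple_uniqP.
pose h (s : 'S_k) : {ffun 'I_k -> 'I_d} := [ffun i => tnth t (s i)].
have h_inj : injective h.
  move=> s1 s2 /ffunP e; apply/permP => i; apply: t_inj.
  by have := e i; rewrite !ffunE.
rewrite (eq_bigl (fun f => f \in [set h s | s in [set: 'S_k]]%SET)); last first.
  move=> f; apply/andP/imsetP => [[f_inj /eqP ft]|[s _ ->]].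
    have /tuple_permP[s e] : perm_eq [tuple f i | i < k] t by rewrite -ft.
    exists s => //; apply/ffunP => i; rewrite ffunE.
    have := congr1 (fun u : k.-tuple 'I_d => tnth u i) (val_inj e).
    by rewrite !tnth_mktuple.
  have hinj : injective (h s) by move=> i j; rewrite !ffunE => /t_inj/perm_inj.
  split; first exact/injectiveP.
  have sh : perm_eq (srt (h s)) t.
    rewrite perm_sym; apply: perm_trans (srt_perm _); rewrite perm_sym.
    apply/tuple_permP; exists s; congr val; apply: eq_from_tnth => i.
    by rewrite !tnth_mktuple ffunE.
  apply/eqP/val_inj/(inj_map val_inj) => /=.
  apply: (@sorted_eq _ leq) => //; [exact: leq_trans|exact: anti_leq| | |].
  - rewrite sorted_map; apply: sort_sorted => i j; exact: leq_total.
  - by apply: sub_sorted t_sorted; apply: ltnW.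
  - exact: perm_map sh.
rewrite big_imset /=; last by move=> ? ? _ _; apply: h_inj.
rewrite (eq_bigl xpredT); last by move=> s; rewrite inE.
rewrite {2}/determinant big_distrl /=; apply: eq_bigr => s _.
have -> : rowsub (h s) B = row_perm s (rowsub (tnth t) B).
  by apply/matrixP => i j; rewrite !mxE ffunE.
rewrite row_permE det_mulmx det_perm mulrCA mulrA; congr (_ * _ * _).
by apply: eq_bigr => i _; rewrite !mxE ffunE.
Qed.

Lemma sum_minor_index d k (F : k.-tuple 'I_d -> K) :
  \sum_(t : k.-tuple 'I_d | sorted ltn (map val t)) F t =
  \sum_(i : 'I_('C(d, k))) F (minor_index i).
Proof.
rewrite (eq_bigl (fun t => t \in [set t : k.-tuple 'I_d | sorted ltn (map val t)]%SET)); last first.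
  by move=> t; rewrite inE.
rewrite big_enum_val /= (reindex (cast_ord (esym (card_ltn_sorted_tuples k d)))) //.
by exists (cast_ord (card_ltn_sorted_tuples k d)) => i _; rewrite ?cast_ordK ?cast_ordKV.
Qed.

Lemma sum_sorted_tuples_sets d k (F : {set 'I_d} -> K) :
  \sum_(t : k.-tuple 'I_d | sorted ltn (map val t)) F [set i in t]%SET =
  \sum_(S : {set 'I_d} | #|S| == k) F S.
Proof.
pose srtd := [set t : k.-tuple 'I_d | sorted ltn (map val t)]%SET.
pose supp (t : k.-tuple 'I_d) := [set i in t]%SET.
have supp_inj : {in srtd &, injective supp}.
  move=> t u; rewrite !inE => t_srt u_srt /setP e.
  apply/val_inj/(inj_map val_inj)/(irr_sorted_eq ltn_trans ltnn) => //= y.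
  by apply/mapP/mapP => -[x xt ->]; exists x => //; have := e x; rewrite !inE xt.
rewrite (eq_bigl (mem srtd)); last by move=> t; rewrite !inE.
rewrite -(big_imset F supp_inj); apply: eq_bigl => S.
suff -> : supp @: srtd = [set S : {set 'I_d} | #|S| == k]%SET by rewrite inE.
apply/eqP; rewrite eqEcard card_in_imset // card_ltn_sorted_tuples card_draws card_ord leqnn andbT.
apply/fintype.subsetP => _ /imsetP[t + ->]; rewrite !inE => t_srt.
rewrite cardsE (card_uniqP _) ?size_tuple // -(map_inj_uniq val_inj).
exact: (sorted_uniq ltn_trans ltnn).
Qed.

Lemma minor_index_sorted d k (i : 'I_('C(d, k))) :
  sorted ltn (map val (minor_index i)).
Proof. by have := enum_valP (cast_ord (esym (card_ltn_sorted_tuples k d)) i); rewrite inE. Qed.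

Lemma ext_power_mul d k (A B : 'M[K]_d) :
  ext_power k (A *m B) = ext_power k A *m ext_power k B.
Proof.
apply/matrixP => i j; rewrite !mxE mxsub_mul Cauchy_Binet sum_minor_index.
by apply: eq_bigr => l _; rewrite !mxE -!mxsub_comp.
Qed.

(** The exponent is positive because [ext_power_mul] gives no information on the
    exterior power of the identity. *)
Lemma ext_power_exp d k (A : 'M[K]_d) m :
  ext_power k (A ^+ m.+1) = ext_power k A ^+ m.+1.
Proof. by elim: m => [|m IHm]; rewrite ?expr1 // exprS ext_power_mul IHm [RHS]exprS. Qed.

End CauchyBinet.

Lemma map_ext_power (K L : comNzRingType) (f : {rmorphism K -> L}) d k (A : 'M[K]_d) :
  map_mx f (ext_power k A) = ext_power k (map_mx f A).
Proof. by apply/matrixP => i j; rewrite !mxE -det_map_mx map_mxsub. Qed.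

Section Trace.
Variable C : numClosedFieldType.

Lemma trigonalize d (A : 'M[C]_d) :
  exists P : 'M[C]_d, P \in unitmx /\ is_trig_mx (P *m A *m invmx P).
Proof.
case: d A => [|d] A.
  by exists 1%:M; rewrite unitmx1; split=> //; apply/is_trig_mxP => -[].
have [//|P /unitarymx_unit Pu] := @Schur C _ A.
by rewrite /similar_to conjumx //; exists P.
Qed.

Lemma mxtrace_conj n (P A : 'M[C]_n) :
  P \in unitmx -> \tr (P *m A *m invmx P) = \tr A.
Proof. by move=> Pu; rewrite mxtrace_mulC mulmxA mulVmx ?mul1mx. Qed.

Lemma mxtrace_ext_power_conj d k (P A : 'M[C]_d) :
  P \in unitmx -> \tr (ext_power k (P *m A *m invmx P)) = \tr (ext_power k A).
Proof.
move=> Pu; rewrite ext_power_mul mxtrace_mulC -ext_power_mul.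
by rewrite mulmxA mulVmx ?mul1mx.
Qed.

(** A minor of a triangular matrix with the same increasing rows and columns is
    again triangular. *)
Lemma mxtrace_ext_power_trig d k (A : 'M[C]_d) : is_trig_mx A ->
  \tr (ext_power k A) = \sum_(S : {set 'I_d} | #|S| == k) \prod_(i in S) A i i.
Proof.
move=> /is_trig_mxP Atrig.
rewrite /mxtrace; under eq_bigr => i _.
  rewrite mxE det_trig; last first.
    apply/is_trig_mxP => a b ab; rewrite mxE Atrig //.
    have := minor_index_sorted i.
    move/(sorted_ltn_nth ltn_trans 0%N) => /(_ a b).
    rewrite !inE size_map size_tuple !ltn_ord => /(_ isT isT ab).
    by rewrite !(nth_map (tnth (minor_index i) a)) ?size_tuple // -!tnth_nth.
  over.
rewrite -(sum_minor_index (fun t => \prod_(j < k) (mxsub (tnth t) (tnth t) A) j j)).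
rewrite -(sum_sorted_tuples_sets _ (fun S => \prod_(i in S) A i i)).
apply: eq_bigr => t t_srt.
have t_uniq : uniq t.
  by rewrite -(map_inj_uniq val_inj); apply: (sorted_uniq ltn_trans ltnn).
under [RHS]eq_bigl => i do rewrite inE.
rewrite -big_uniq // big_tuple.
by apply: eq_bigr => i _; rewrite mxE.
Qed.

(** Both sides are invariant under conjugation; for a triangular matrix with
    diagonal [l_i] this is the expansion of [\prod_i (1 - l_i)] over subsets,
    grouped by cardinality. *)
Lemma alt_sum_mxtrace_ext_power d (A : 'M[C]_d) :
  \sum_(k < d.+1) (-1) ^+ k * \tr (ext_power k A) = \det (1%:M - A).
Proof.
have [P [Pu]] := trigonalize A; set T := P *m A *m invmx P => Ttrig.
have -> : \det (1%:M - A) = \prod_i (1 - T i i).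
  have -> : \det (1%:M - A) = \det (1%:M - T).
    have -> : 1%:M - T = P *m (1%:M - A) *m invmx P.
      by rewrite mulmxBr mulmxBl mulmx1 mulmxV.
    by rewrite !det_mulmx mulrAC -det_mulmx mulmxV // det1 mul1r.
  rewrite det_trig; first by apply: eq_bigr => i _; rewrite !mxE eqxx.
  apply/is_trig_mxP => i j ij; rewrite [LHS]mxE [X in _ + X]mxE (is_trig_mxP Ttrig) // mxE.
  by rewrite -val_eqE /= ltn_eqF // subrr.
under [LHS]eq_bigr => k _.
  rewrite -(mxtrace_ext_power_conj k A Pu) -/T (mxtrace_ext_power_trig k Ttrig).
  over.
rewrite [RHS](eq_bigr (fun i => - T i i + 1)) => [|i _]; last by rewrite addrC.
rewrite bigA_distr /= (partition_big (fun J : {set 'I_d} => inord #|J| : 'I_d.+1) xpredT) //=.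
apply: eq_bigr => k _; rewrite big_distrr /=.
apply: eq_big => J; first by rewrite -val_eqE /= inordK // ltnS -[d in (_ <= d)%N]card_ord max_card.
move=> /eqP Jk; transitivity (\prod_(i in J) - T i i); last by rewrite [LHS]big_mkcond.
by rewrite prodrN -Jk.
Qed.

End Trace.

(** * Power series and logarithmic derivatives *)

Section PowerSeries.
Variable K : comNzRingType.
Implicit Types (f g h s t : nat -> K) (p q : {poly K}).

(** Product of power series given by their coefficients.  Its laws are inherited
    from polynomials: the coefficient of index [n] depends only on the
    truncations ([cut]) of the factors. *)
Definition conv f g n : K := \sum_(i < n.+1) f i * g (n - i)%N.

Lemma coefM_conv p q f g n :
    (forall i, (i <= n)%N -> p`_i = f i) -> (forall i, (i <= n)%N -> q`_i = g i) ->
  (p * q)`_n = conv f g n.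
Proof.
move=> pf qg; rewrite coefM; apply: eq_bigr => i _.
by rewrite pf ?qg ?leq_subr // -ltnS.
Qed.

Definition cut n f : {poly K} := \poly_(i < n.+1) f i.

Lemma coef_cut n f i : (i <= n)%N -> (cut n f)`_i = f i.
Proof. by move=> le_in; rewrite coef_poly ltnS le_in. Qed.

Lemma coef_cutM n f g i : (i <= n)%N -> (cut n f * cut n g)`_i = conv f g i.
Proof. by move=> le_in; apply: coefM_conv => j ji; rewrite coef_cut ?(leq_trans ji). Qed.

Lemma eq_conv f g f' g' : f =1 f' -> g =1 g' -> conv f g =1 conv f' g'.
Proof. by move=> ff gg n; apply: eq_bigr => i _; rewrite ff gg. Qed.

Lemma convC f g : conv f g =1 conv g f.
Proof. by move=> n; rewrite -!(@coef_cutM n) // mulrC. Qed.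

Lemma convA f g h : conv f (conv g h) =1 conv (conv f g) h.
Proof.
move=> n; transitivity ((cut n f * (cut n g * cut n h))`_n).
  by apply/esym/coefM_conv => i lein; rewrite ?coef_cut ?coef_cutM.
rewrite mulrA.
by apply/coefM_conv => i lein; rewrite ?coef_cut ?coef_cutM.
Qed.

Lemma convDr f g h n : conv f (fun i => g i + h i) n = conv f g n + conv f h n.
Proof. by rewrite -big_split; apply: eq_bigr => i _; rewrite mulrDr. Qed.

(** [f' = f s], that is, [s] is the logarithmic derivative of [f]. *)
Definition logder f s := forall n, f n.+1 *+ n.+1 = conv f s n.

Lemma conv_deriv f g n :
  conv f g n.+1 *+ n.+1 =
  conv (fun i => f i.+1 *+ i.+1) g n + conv f (fun i => g i.+1 *+ i.+1) n.
Proof.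
rewrite -(@coef_cutM n.+1) // -coef_deriv derivM coefD.
by congr (_ + _); apply: coefM_conv => i lein; rewrite ?coef_deriv coef_cut // ltnW.
Qed.

Lemma logder_conv f g s t :
  logder f s -> logder g t -> logder (conv f g) (fun i => s i + t i).
Proof.
move=> fs gt n; rewrite conv_deriv convDr; congr (_ + _).
  rewrite (eq_conv fs (frefl g)) -!convA; apply: eq_conv => // i; exact: convC.
by rewrite (eq_conv (frefl f) gt) convA.
Qed.

Lemma logder_prod (I : Type) (r : seq I) (P : pred I) (F : I -> {poly K}) (s : I -> nat -> K) :
    (forall i, P i -> logder (fun n => (F i)`_n) (s i)) ->
  logder (fun n => (\prod_(i <- r | P i) F i)`_n) (fun n => \sum_(i <- r | P i) s i n).
Proof.
move=> Fs; elim: r => [|i r IHr] n.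
  rewrite big_nil coef1 mul0rn /conv big1 // => i _.
  by rewrite big_nil mulr0.
case Pi: (P i); rewrite big_cons Pi; last first.
  by rewrite IHr; apply: eq_bigr => j _; rewrite big_cons Pi.
have FE m : (F i * \prod_(j <- r | P j) F j)`_m =
    conv (fun n => (F i)`_n) (fun n => (\prod_(j <- r | P j) F j)`_n) m.
  exact: coefM_conv.
rewrite FE (logder_conv (Fs i Pi) IHr); apply: eq_conv => m; first by rewrite FE.
by rewrite big_cons Pi.
Qed.

(** [-a / (1 - a z)] is a geometric series. *)
Lemma logder_1subX (a : K) : logder (fun n => (1 - a *: 'X)`_n) (fun n => - a ^+ n.+1).
Proof.
move=> n; rewrite coefB coef1 coefZ coefX sub0r.
rewrite /conv big_ord_recl coefB coef1 coefZ coefX mulr0 subr0 mul1r subn0.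
case: n => [|n]; first by rewrite big_ord0 mulr1 addr0 mulr1n.
rewrite big_ord_recl coefB coef1 coefZ coefX big1 ?addr0 => [|i _].
  by rewrite mulr0 oppr0 mul0rn sub0r mulr1 mulrNN /= subSS subn0 [a ^+ n.+2]exprS addNr.
by rewrite coefB coef1 coefZ coefX /= mulr0 subr0 mul0r.
Qed.

End PowerSeries.

(** In characteristic [0] the equation [f' = f s] determines each coefficient
    from the previous ones. *)
Lemma logder_uniq (K : numDomainType) (f g s : nat -> K) :
  logder f s -> logder g s -> f 0%N = g 0%N -> f =1 g.
Proof.
move=> fs gs fg0 n; elim/ltn_ind: n => -[//|n] IHn.
have n0 : n.+1%:R != 0 :> K by rewrite pnatr_eq0.
apply: (mulIf n0); rewrite !mulr_natr fs gs; apply: eq_bigr => i _.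
by rewrite IHn.
Qed.

Section Exponential.
Implicit Types b : nat -> rat.

Definition exp_arg b n : {poly rat} := \sum_(1 <= m < n.+1) b m *: 'X^m.

Lemma coef_exp_arg b n i : (i <= n)%N -> (exp_arg b n)`_i = b i *+ (0 < i)%N.
Proof.
move=> lein; rewrite coef_sum; case: i lein => [_|i lein].
  rewrite big_nat_cond big1 // => -[//|m] _; by rewrite coefZ coefXn mulr0.
rewrite (bigD1_seq i.+1) ?mem_index_iota ?iota_uniq //= coefZ coefXn eqxx mulr1.
by rewrite big1 ?addr0 // => m mi; rewrite coefZ coefXn eq_sym (negPf mi) mulr0.
Qed.

Lemma coef_exp_eq (K : comNzRingType) (p q : {poly K}) n :
    (forall i, (i <= n)%N -> p`_i = q`_i) ->
  forall k i, (i <= n)%N -> (p ^+ k)`_i = (q ^+ k)`_i.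
Proof.
move=> pq; elim=> [//|k IHk] i lein; rewrite !exprS.
rewrite (@coefM_conv _ p _ (fun j => q`_j) (fun j => (q ^+ k)`_j)).
- by apply/esym/coefM_conv.
- by move=> j ji; rewrite pq ?(leq_trans ji).
- by move=> j ji; rewrite IHk ?(leq_trans ji).
Qed.

Lemma coef_exp_small (K : comNzRingType) (p : {poly K}) k i :
  p`_0 = 0 -> (i < k)%N -> (p ^+ k)`_i = 0.
Proof.
move=> p0 ik; have -> : p = 'X * drop_poly 1 p.
  rewrite mulrC -['X]expr1 -[LHS](poly_take_drop 1) [X in X + _](_ : _ = 0) ?add0r //.
  by apply/polyP => -[|j]; rewrite coef_take_poly coef0.
by rewrite exprMn coefXnM ik.
Qed.

(** The coefficient of index [n] does not change when the truncation order is
    increased: the new terms of the exponent have degree larger than [n], and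
    its powers beyond the [n]-th have no term of degree at most [n], as it has no
    constant term.  One can thus work at order [n.+1] to differentiate. *)
Lemma fps_exp_stable b N n : (n <= N)%N ->
  fps_exp b n = (\sum_(k < N.+1) k`!%:R^-1 *: exp_arg b N ^+ k)`_n.
Proof.
move=> lenN; rewrite /fps_exp -/(exp_arg b n) !coef_sum.
have P0 M : (exp_arg b M)`_0 = 0 by rewrite coef_exp_arg.
rewrite -(big_mkord xpredT (fun k => (k`!%:R^-1 *: exp_arg b n ^+ k)`_n)).
rewrite -(big_mkord xpredT (fun k => (k`!%:R^-1 *: exp_arg b N ^+ k)`_n)).
rewrite [RHS](@big_cat_nat _ _ _ n.+1) //= [X in _ = _ + X]big_nat_cond.
rewrite [X in _ = _ + X]big1 ?addr0 => [|k /andP[/andP[nk _] _]]; last first.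
  by rewrite coefZ coef_exp_small ?mulr0.
apply: eq_bigr => k _; rewrite !coefZ; congr (_ * _).
apply: coef_exp_eq (leqnn n) => i lein.
by rewrite !coef_exp_arg // (leq_trans lein).
Qed.

Lemma logder_fps_exp b : logder (fps_exp b) (fun m => b m.+1 *+ m.+1).
Proof.
move=> n; rewrite (@fps_exp_stable b n.+1) // -coef_deriv.
set P := exp_arg b n.+1.
have -> : (\sum_(k < n.+2) k`!%:R^-1 *: P ^+ k)^`() =
  (\sum_(k < n.+1) k`!%:R^-1 *: P ^+ k) * P^`().
  rewrite raddf_sum /= big_ord_recl /= expr0 derivZ derivC scaler0 add0r big_distrl /=.
  apply: eq_bigr => i _; rewrite derivZ deriv_exp /= -scalerAl -scaler_nat scalerA [P^`() * _]mulrC.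
  congr (_ *: _); rewrite factS natrM invfM mulrAC mulVf ?mul1r ?pnatr_eq0 //.
apply: coefM_conv => i lein.
  rewrite (@fps_exp_stable b n.+1 i) ?(leqW lein) //.
  (* The derivative lacks the last power, which is invisible at order [n]. *)
  rewrite [in RHS]big_ord_recr /= coefD [X in _ + X]coefZ.
  rewrite [X in _ + _ * X]coef_exp_small ?mulr0 ?addr0 //.
  by rewrite coef_exp_arg.
by rewrite coef_deriv coef_exp_arg.
Qed.

Lemma fps_exp0 b : fps_exp b 0 = 1.
Proof.
by rewrite /fps_exp big_ord_recl big_ord0 addr0 fact0 invr1 scale1r expr0 coef1.
Qed.

End Exponential.

(** * Characteristic polynomials and the rational function *)

Lemma trig_exp (K : comNzRingType) n (A : 'M[K]_n) m : is_trig_mx A ->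
  is_trig_mx (A ^+ m) /\ forall i, (A ^+ m) i i = A i i ^+ m.
Proof.
move=> /is_trig_mxP Atrig; elim: m => [|m [/is_trig_mxP IHt IHd]].
  split=> [|i]; last by rewrite !expr0 mxE eqxx.
  by apply/is_trig_mxP => i j ij; rewrite expr0 mxE -val_eqE ltn_eqF.
split=> [|i].
  apply/is_trig_mxP => i j ij; rewrite exprS mxE big1 // => l _.
  have [il|li] := ltnP i l; first by rewrite Atrig ?mul0r.
  by rewrite IHt ?mulr0 // (leq_ltn_trans li).
rewrite exprS mxE (bigD1 i) //= IHd -exprS big1 ?addr0 // => l li.
have [il|] := ltnP i l; first by rewrite Atrig ?mul0r.
by rewrite leq_eqVlt val_eqE (negPf li) /= => {}li; rewrite IHt ?mulr0.
Qed.

Lemma conj_exp (K : comUnitRingType) n (P A : 'M[K]_n) m : P \in unitmx ->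
  (P *m A *m invmx P) ^+ m = P *m (A ^+ m) *m invmx P.
Proof.
move=> Pu; elim: m => [|m IHm]; first by rewrite !expr0 mulmx1 mulmxV.
rewrite exprS IHm [in RHS]exprS -[LHS]/(_ *m _) -[X in _ = _ *m X *m _]/(_ *m _).
by rewrite !mulmxA mulmxKV.
Qed.

(** The reciprocal polynomial of the characteristic polynomial of [B]. *)
Definition rev_char_poly (K : comNzRingType) n (B : 'M[K]_n) : {poly K} :=
  \det (1%:M - 'X *: map_mx polyC B).

(** After triangularization, [\det (1 - z B)] is the product of the
    [1 - l_i z], and the traces of the powers of [B] are the power sums of the
    [l_i]: these are Newton's identities. *)
Lemma logder_rev_char_poly_closed (C : numClosedFieldType) n (B : 'M[C]_n) :
  logder (fun i => (rev_char_poly B)`_i) (fun m => - \tr (B ^+ m.+1)).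
Proof.
have [P [Pu]] := trigonalize B; set T := P *m B *m invmx P => Ttrig.
have -> : rev_char_poly B = \prod_i (1 - T i i *: 'X).
  have -> : rev_char_poly B = rev_char_poly T.
    pose Q := map_mx polyC P; pose Q' := map_mx polyC (invmx P).
    have QQ' : Q *m Q' = 1%:M by rewrite -map_mxM mulmxV // map_mx1.
    rewrite /rev_char_poly; have -> : 1%:M - 'X *: map_mx polyC T =
        Q *m (1%:M - 'X *: map_mx polyC B) *m Q'.
      rewrite mulmxBr mulmxBl mulmx1 QQ' -scalemxAr -scalemxAl.
      by rewrite /T 2!map_mxM.
    by rewrite !det_mulmx mulrAC -det_mulmx QQ' det1 mul1r.
  rewrite /rev_char_poly det_trig.
    by apply: eq_bigr => i _; rewrite !mxE eqxx mulrC mul_polyC.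
  apply/is_trig_mxP => i j ij; rewrite !mxE.
  have := is_trig_mxP Ttrig i j ij; rewrite mxE => ->.
  by rewrite -val_eqE ltn_eqF // polyC0 mulr0 subrr.
have trE m : \tr (B ^+ m) = \sum_i T i i ^+ m.
  rewrite -(mxtrace_conj _ Pu) -conj_exp // -/T /mxtrace.
  by apply: eq_bigr => i _; have [_ ->] := trig_exp m Ttrig.
move=> j; rewrite (logder_prod (index_enum _) (P := xpredT) (fun i _ => logder_1subX (T i i))).
by apply: eq_conv => // m; rewrite trE sumrN.
Qed.

Lemma map_rev_char_poly (K L : comNzRingType) (f : {rmorphism K -> L}) n (B : 'M[K]_n) :
  map_poly f (rev_char_poly B) = rev_char_poly (map_mx f B).
Proof.
rewrite /rev_char_poly -det_map_mx; congr (\det _).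
apply/matrixP => i j; rewrite !mxE rmorphB rmorphM /= map_polyX map_polyC /=.
by rewrite rmorph_nat.
Qed.

Lemma map_mx_exp (K L : comNzRingType) (f : {rmorphism K -> L}) n (B : 'M[K]_n) m :
  map_mx f (B ^+ m) = map_mx f B ^+ m.
Proof. exact: (rmorphXn (map_mx f)). Qed.

Lemma scalemx_exp (K : comNzRingType) n c (B : 'M[K]_n) m :
  (c *: B) ^+ m = c ^+ m *: B ^+ m.
Proof.
elim: m => [|m IHm]; first by rewrite !expr0 scale1r.
by rewrite !exprS IHm -[LHS]/(_ *m _) -scalemxAl -scalemxAr scalerA.
Qed.

Lemma logder_rev_char_poly n (B : 'M[rat]_n) :
  logder (fun i => (rev_char_poly B)`_i) (fun m => - \tr (B ^+ m.+1)).
Proof.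
move=> i; apply: (fmorph_inj (ratr : {rmorphism rat -> algC})).
rewrite rmorphMn /= -coef_map map_rev_char_poly logder_rev_char_poly_closed.
rewrite /conv rmorph_sum; apply: eq_bigr => j _ /=.
by rewrite rmorphM /= -map_rev_char_poly coef_map rmorphN -map_mx_exp trace_map_mx.
Qed.

Lemma rev_char_poly0 (K : comNzRingType) n (B : 'M[K]_n) : (rev_char_poly B).[0] = 1.
Proof.
rewrite -[LHS]/(horner_eval 0 _) -det_map_mx -[RHS](det1 _ n); congr (\det _).
apply/matrixP => i j; rewrite !mxE /= /horner_eval !hornerE.
by case: (i == j); rewrite !(mulr1n, mulr0n, hornerE, subr0).
Qed.

Section Assembly.
Variables (d : nat) (M : 'M[int]_d).

Lemma alt_sum_mxtrace_ext_power_exp m : (0 < m)%N ->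
  \sum_(k < d.+1) (-1) ^+ k * \tr (ext_power k M ^+ m) = \det (1%:M - M ^+ m).
Proof.
case: m => // m _.
apply: (@intr_inj algC).
rewrite -det_map_mx map_mxB map_mx1 -alt_sum_mxtrace_ext_power rmorph_sum /=.
apply: eq_bigr => k _; rewrite rmorphM rmorphXn /= rmorphN1; congr (_ * _).
by rewrite -ext_power_exp -map_ext_power trace_map_mx.
Qed.

Lemma ext_factorE (delta : int) k :
  ext_factor M delta k = rev_char_poly (delta%:~R *: map_mx intr (ext_power k M)).
Proof.
congr (\det (_ - _)); apply/matrixP => i j; rewrite !mxE.
by rewrite mulrAC mulrC polyCM -!(rmorph_int polyC).
Qed.

Lemma logder_ext_factor (delta : int) k :
  logder (fun i => (ext_factor M delta k)`_i)
         (fun m => - (delta ^+ m.+1 * \tr (ext_power k M ^+ m.+1))%:~R).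
Proof.
move=> n; rewrite ext_factorE logder_rev_char_poly; apply: eq_conv => // m.
by rewrite scalemx_exp mxtraceZ -map_mx_exp trace_map_mx rmorphM rmorphXn.
Qed.

(** The numerator [p] collects the factors of exponent [1] and the denominator [q]
    those of exponent [-1]; [q] times the exponential and [p] have the same
    logarithmic derivative by [alt_sum_mxtrace_ext_power_exp]. *)
Lemma expansion_zeta_ratfun (delta eps : int) (a : nat -> nat) :
    delta = 1 \/ delta = -1 -> eps = 1 \/ eps = -1 ->
    (forall m, (0 < m)%N -> (a m)%:Z = eps * delta ^+ m * \det (1%:M - M ^+ m)) ->
  expansion_at0 (zeta_ratfun M delta eps) (fps_exp (fun m => (a m)%:R / m%:R)).
Proof.
move=> delta1 eps1 aE.
(* The exponent of the k-th determinant. *)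
pose e k : int := eps * (-1) ^+ k.+1.
have eN k : e k != 1 -> e k = -1.
  by rewrite /e -signr_odd; case: eps1 => ->; case: odd; rewrite ?mulr1 ?mul1r ?mulrN1 ?opprK ?eqxx.
pose p := \prod_(k < d.+1 | e k == 1) ext_factor M delta k.
pose q := \prod_(k < d.+1 | e k != 1) ext_factor M delta k.
exists p, q; split.
- rewrite horner_prod big1 ?oner_eq0 // => k _.
  by rewrite ext_factorE rev_char_poly0.
- rewrite /zeta_ratfun (bigID (fun k : 'I_d.+1 => e k == 1)) /=.
  rewrite /p /q !rmorph_prod -prodfV /=; congr (_ * _); apply: eq_bigr => k.
    by rewrite -/(e k) => /eqP ->; rewrite expr1z.
  by rewrite -/(e k) => /eN ->.
pose F := fps_exp (fun m => (a m)%:R / m%:R); rewrite -/F.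
pose s k m : rat := - (delta ^+ m.+1 * \tr (ext_power k M ^+ m.+1))%:~R.
have lF : logder F (fun m => (a m.+1)%:R).
  move=> n; rewrite logder_fps_exp; apply: eq_conv => // m.
  by rewrite -[_ *+ _]mulr_natr mulfVK // pnatr_eq0.
have lp := logder_prod (index_enum _) (P := fun k : 'I_d.+1 => e k == 1)
  (fun k _ => logder_ext_factor delta k).
have lq := logder_prod (index_enum _) (P := fun k : 'I_d.+1 => e k != 1)
  (fun k _ => logder_ext_factor delta k).
apply: (logder_uniq (s := fun m => \sum_(k < d.+1 | e k == 1) s k m)).
- move=> n; rewrite (logder_conv lq lF); apply: eq_conv => // m.
  have -> : (a m.+1)%:R = \sum_(k < d.+1) (e k)%:~R * s k m :> rat.
    rewrite -[LHS]/((a m.+1)%:Z%:~R) aE // -alt_sum_mxtrace_ext_power_exp //.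
    rewrite big_distrr rmorph_sum /=.
    apply: eq_bigr => k _; rewrite /s -rmorphN -rmorphM; congr (_%:~R).
    rewrite /e [(-1) ^+ k.+1]exprS; ring.
  rewrite [X in _ + X](bigID (fun k : 'I_d.+1 => e k == 1)) /= addrCA -big_split /=.
  rewrite [X in _ + X]big1 ?addr0 => [|k /eN ->]; last by rewrite mulN1r addrN.
  by apply: eq_bigr => k /eqP ->; rewrite mul1r.
- exact: lp.
- rewrite big_ord1 subnn /F fps_exp0 mulr1 -!horner_coef0 !horner_prod.
  by rewrite !big1 // => k _; rewrite ext_factorE rev_char_poly0.
Qed.

End Assembly.

(** * Signs of the determinants *)

Lemma det_prod_roots (K : comNzRingType) d (A : 'M[K]_d.+1) m (r : seq K) :
    'X^m - 1 = \prod_(z <- r) ('X - z%:P) ->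
  \det (A ^+ m - 1%:M) = \prod_(z <- r) \det (A - z%:M).
Proof.
move=> /(congr1 (horner_mx A)).
rewrite rmorphB rmorphXn /= horner_mx_X (rmorph1 (horner_mx A)) rmorph_prod /= => ->.
rewrite (big_morph (fun B : 'M[K]_(d.+1) => \det B) (@det_mulmx _ _) (det1 _ _)).
by apply: eq_bigr => z _; rewrite rmorphB /= horner_mx_X horner_mx_C.
Qed.

Section PairedProduct.
Variable C : numClosedFieldType.

Lemma prod_nat_rev_tail (f : nat -> C) m j : (j < m)%N ->
  \prod_(m - j <= k < m) f k = \prod_(1 <= k < j.+1) f (m - k)%N.
Proof.
elim: j => [|j IHj] jm; first by rewrite subn0 !big_geq.
rewrite big_ltn ?ltn_subrL ?(leq_ltn_trans _ jm) // [RHS]big_nat_recr //= mulrC.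
by rewrite -IHj 1?ltnW // subnSK 1?ltnW.
Qed.

(** Pairing [k] with [m - k] leaves only the middle index, present when [m] is
    even. *)
Lemma prod_conj_pairs (f : nat -> C) m : (0 < m)%N ->
    (forall k, (0 < k < m)%N -> f (m - k)%N = Num.conj (f k)) ->
  exists2 c : C, 0 <= c &
    \prod_(1 <= k < m) f k = (if odd m then 1 else f m./2) * c.
Proof.
(* The number of pairs. *)
move=> m0 fconj; pose j := (m.-1)./2.
have jm : (j < m)%N by rewrite /j; lia.
exists (\prod_(1 <= k < j.+1) (f k * Num.conj (f k))).
  by apply: prodr_ge0 => k _; rewrite mul_conjC_ge0.
have tailE : \prod_(m - j <= k < m) f k = \prod_(1 <= k < j.+1) Num.conj (f k).
  rewrite prod_nat_rev_tail //; apply: eq_big_nat => k kj.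
  rewrite fconj //; move: kj; rewrite /j; lia.
rewrite big_split /= -tailE mulrCA mulrA.
rewrite (@big_cat_nat _ _ _ j.+1) //=.
rewrite -mulrA; congr (_ * _).
have := odd_double_half m; case: ifPn => [_|_] mE.
  by rewrite mul1r; congr (\prod_(_ <= _ < _) _); rewrite /j; lia.
have -> : (m - j = j.+2)%N by rewrite /j in jm *; lia.
have -> : (m./2 = j.+1)%N by rewrite /j; lia.
by rewrite big_ltn // /j; lia.
Qed.

End PairedProduct.

Section Sign.
Variables (d : nat) (M : 'M[int]_d.+1).

(** With [f k = \det (M - z ^+ k)] for a primitive [m]-th root of unity [z], the
    product of the [f k] is [\det (M ^+ m - 1)].  The factor [f 0] gives
    [\det (1 - M)], up to the same sign [(-1) ^+ d.+1] that occurs on the other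
    side; the middle one, where [z ^+ k = -1], gives [\det (1 + M)], and the
    other ones pair up since [M] is real. *)
Lemma det_1subX_sign m : (0 < m)%N ->
  exists2 c : algC, 0 <= c &
  (\det (1%:M - M ^+ m))%:~R =
    (\det (1%:M - M) * (if odd m then 1 else \det (1%:M + M)))%:~R * c.
Proof.
move=> m0; have [z zm] := C_prim_root_exists m0.
pose A : 'M[algC]_d.+1 := map_mx intr M.
pose f k := \det (A - (z ^+ k)%:M).
have fconj k : (0 < k < m)%N -> f (m - k)%N = Num.conj (f k).
  move=> /andP[k0 km]; rewrite /f -det_map_mx map_mxB map_scalar_mx; congr (\det (_ - _%:M)).
    by apply/matrixP => i j; rewrite /A !mxE /= rmorph_int.
  rewrite /=.
  (* The conjugate of [z ^+ k] is its inverse, as [z] has modulus [1]. *)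
  have z0 : z != 0 by rewrite (prim_root_eq0 zm) gtn_eqF.
  have zk0 : z ^+ k != 0 by rewrite expf_neq0.
  have nz : `|z| = 1.
    by apply/eqP; rewrite -(pexpr_eq1 m0) ?normr_ge0 // -normrX (prim_expr_order zm) normr1.
  apply: (mulIf zk0); rewrite -exprD subnK 1?ltnW // (prim_expr_order zm).
  by rewrite mulrC -normCK normrX nz !expr1n.
have [c c0 cE] := prod_conj_pairs m0 fconj; exists c => //.
have := @det_prod_roots _ _ A m [seq z ^+ i | i <- index_iota 0 m].
rewrite !big_map (factor_Xn_sub_1 zm) => /(_ erefl).
rewrite big_ltn // expr0 cE -/f => detE.
have sgnE (B : 'M[int]_d.+1) : (\det (1%:M - B))%:~R =
    (-1) ^+ d.+1 * \det (map_mx intr B - 1%:M : 'M[algC]_d.+1).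
  by rewrite -det_map_mx map_mxB map_mx1 -detZ scaleN1r opprB.
rewrite sgnE map_mx_exp detE rmorphM /= sgnE -/A !mulrA; congr (_ * _ * _).
case: ifPn => // meven; rewrite /f -det_map_mx map_mxD map_mx1 -/A.
have -> : z ^+ m./2 = -1.
  have : (z ^+ m./2) ^+ 2 == 1.
    by rewrite -exprM muln2 even_halfK // (prim_expr_order zm).
  rewrite sqrf_eq1 -(prim_order_dvd zm) => /orP[/dvdn_leq|/eqP //]; lia.
by rewrite raddfN /= opprK addrC.
Qed.

(** When [\det (1 - M ^+ m)] is nonzero, both hypotheses on the signs that are
    relevant for the parity of [m] apply. *)
Lemma abs_det_1subX (delta eps : int) m : (0 < m)%N ->
    delta = 1 \/ delta = -1 ->
    (\det (1%:M - M) != 0 -> eps = delta * Num.sg (\det (1%:M - M))) ->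
    (\det (1%:M + M) != 0 -> delta = Num.sg (\det (1%:M + M))) ->
  `|\det (1%:M - M ^+ m)| = eps * delta ^+ m * \det (1%:M - M ^+ m).
Proof.
move=> m0 delta1 epsE deltaE.
have [c c0 cE] := det_1subX_sign m0.
pose w := \det (1%:M - M) * (if odd m then 1 else \det (1%:M + M)).
suff H : w != 0 -> eps * delta ^+ m = Num.sg w.
  have [w0|w0] := eqVneq w 0.
    by move: cE; rewrite -/w w0 mul0r => /eqP; rewrite intr_eq0 => /eqP ->; rewrite mulr0 normr0.
  rewrite H //; apply: (@intr_inj algC).
  rewrite intr_norm rmorphM /= cE normrM (ger0_norm c0) mulrA -intr_norm -/w; congr (_ * c).
  by rewrite -intrM normrEsg.
rewrite mulf_eq0 negb_or => /andP[/epsE -> w2].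
have -> : delta ^+ m = if odd m then delta else 1.
  by case: delta1 => ->; rewrite ?expr1n ?if_same // -signr_odd; case: odd.
rewrite /w; case: odd w2 => [_|/deltaE dE].
  by rewrite mulr1; case: delta1 => ->; ring.
by rewrite mulr1 sgrM mulrC -dE.
Qed.

End Sign.

(** The sign of the leading term of [P] at [1] is the sign of [P.[1]] itself when
    the latter does not vanish, for then [t = 0]. *)
Lemma sg_divp_Xsub1 (P R : {poly int}) t :
    P = R * ('X - 1) ^+ t -> R.[1] != 0 ->
  let s := Num.sg (P %/ ('X - 1) ^+ t).[1] in
  (s = 1 \/ s = -1) /\ (P.[1] != 0 -> s = Num.sg P.[1]).
Proof.
move=> PE R1 /=.
have -> : P %/ ('X - 1) ^+ t = R.
  by rewrite PE Pdiv.IdomainMonic.mulpK // monic_exp // -['X - 1]/('X - 1%:P) monicXsubC.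
split; first by case: (ltgtP R.[1] 0) R1 => [/ltr0_sg ->|/gtr0_sg ->|//] _; [right|left].
rewrite PE; case: t {PE} => [|t]; first by rewrite expr0 mulr1.
have -> : (R * ('X - 1) ^+ t.+1).[1] = 0.
  by rewrite exprS !hornerM (hornerXsubC 1 1) subrr mul0r mulr0.
by rewrite eqxx.
Qed.

Lemma horner_char_poly (K : comNzRingType) n (A : 'M[K]_n) c :
  (char_poly A).[c] = \det (c%:M - A).
Proof.
rewrite -[LHS]/(horner_eval c _) -det_map_mx; congr (\det _); apply/matrixP => i j.
by rewrite !mxE rmorphB rmorphMn /= /horner_eval hornerX hornerC.
Qed.

Lemma det_oppmx (K : comNzRingType) n (A : 'M[K]_n) :
  \det (- A) = (-1) ^+ n * \det A.
Proof. by rewrite -scaleN1r detZ. Qed.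

Section SignDefs.
Variables (d : nat) (M : 'M[int]_d).

Lemma det_XaddE :
  \det ('X%:M + map_mx polyC M) = (-1) ^+ d *: (char_poly M \Po - 'X).
Proof.
rewrite /char_poly -[_ \Po _]/(comp_poly (- 'X) _) -det_map_mx -mul_polyC polyC_exp polyCN.
rewrite -detZ polyC1 scaleN1r; congr (\det _); apply/matrixP => i j.
rewrite !mxE /= comp_polyB comp_polyC opprB addrC -[in LHS](opprK 'X) mulNrn.
by rewrite rmorphMn /= comp_polyX.
Qed.

Lemma det_Xadd1 : (\det ('X%:M + map_mx polyC M)).[1] = \det (1%:M + M).
Proof.
rewrite -[LHS]/(horner_eval 1 _) -det_map_mx; congr (\det _); apply/matrixP => i j.
by rewrite !mxE rmorphD rmorphMn /= /horner_eval hornerX hornerC.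
Qed.

Lemma delta_eps_signP sigma tau (Q : {poly int}) :
    pm1_factorization M sigma tau Q ->
  let delta := delta_sign M tau in
  let eps := eps_sign M sigma tau in
  [/\ delta = 1 \/ delta = -1, eps = 1 \/ eps = -1,
      \det (1%:M - M) != 0 -> eps = delta * Num.sg (\det (1%:M - M))
    & \det (1%:M + M) != 0 -> delta = Num.sg (\det (1%:M + M))].
Proof.
move=> [chiE Q1 QN1] delta eps.
have [d1 dE] : (delta = 1 \/ delta = -1) /\
    ((\det ('X%:M + map_mx polyC M)).[1] != 0 ->
     delta = Num.sg (\det ('X%:M + map_mx polyC M)).[1]).
  (* The substitution of [- 'X] for ['X] exchanges the roots [1] and [-1]. *)
  apply: (@sg_divp_Xsub1 _ ((-1) ^+ (d + sigma + tau) *: (('X + 1) ^+ sigma * (Q \Po - 'X)))).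
    rewrite det_XaddE chiE !comp_polyM !rmorphXn /= !(comp_polyB, comp_polyD, comp_polyX).
    rewrite !(rmorph1 (comp_poly (- 'X))).
    have -> : - 'X - 1 = - ('X + 1) :> {poly int} by rewrite opprD.
    have -> : - 'X + 1 = - ('X - 1) :> {poly int} by rewrite opprB addrC.
    rewrite -!mul_polyC !polyC_exp polyCN polyC1 !(exprNn (_ + _)) !exprD; ring.
  by rewrite !hornerE horner_comp !hornerE !mulf_neq0 ?expf_neq0 // signr_eq0.
have [e1 eE] : (delta * eps = 1 \/ delta * eps = -1) /\
    ((\det ('X%:M - map_mx polyC M)).[1] != 0 ->
     delta * eps = Num.sg (\det ('X%:M - map_mx polyC M)).[1]).
  rewrite /eps /eps_sign -/delta mulrA.
  have -> : delta * delta = 1 by case: d1 => ->.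
  rewrite mul1r; apply: (@sg_divp_Xsub1 _ (('X + 1) ^+ tau * Q)).
    by rewrite -[LHS]/(char_poly M) chiE; ring.
  by rewrite !hornerE mulf_neq0 ?expf_neq0.
rewrite det_Xadd1 in dE; rewrite [(\det _).[1]]horner_char_poly in eE.
have epsE : eps = delta * (delta * eps) by rewrite mulrA; case: d1 => ->; ring.
split=> //; first by rewrite epsE; case: e1 => ->; case: d1 => ->; auto.
by move=> /eE <-.
Qed.

Lemma pm1_factorization_exists :
  exists (sigma tau : nat) (Q : {poly int}), pm1_factorization M sigma tau Q.
Proof.
have chi0 : char_poly M != 0 by rewrite monic_neq0 ?char_poly_monic.
have [s [P]] := multiplicity_XsubC (char_poly M) 1; rewrite chi0 /= => P1 chiE.
have P0 : P != 0 by apply: contraNneq chi0 => P0; rewrite chiE P0 mul0r.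
have [t [Q]] := multiplicity_XsubC P (-1); rewrite P0 /= => QN1 PE.
exists s, t, Q; split=> //.
  by rewrite chiE PE polyCN opprK polyC1; ring.
by apply: contraNneq P1 => Q1; rewrite PE rootM /root Q1 eqxx.
Qed.

End SignDefs.

(** * Fixed points on the torus *)

Section IntegralVectors.
Variable R : realType.

Definition int_vec n (x : 'cV[R]_n) := forall i, x i ord0 \is a Num.int.

Lemma int_vec_mulmx m n (P : 'M[int]_(m, n)) (x : 'cV[R]_n) :
  int_vec x -> int_vec (map_mx intr P *m x).
Proof. by move=> ix i; rewrite mxE rpred_sum // => j _; rewrite rpredM // mxE intr_int. Qed.

Lemma int_vec_unimodular n (P : 'M[int]_n) (x : 'cV[R]_n) :
  P \in unitmx -> int_vec (map_mx intr P *m x) -> int_vec x.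
Proof.
move=> Pu /(int_vec_mulmx (invmx P)).
by rewrite mulmxA -map_mxM mulVmx // map_mx1 mul1mx.
Qed.

(** The integers are closed in the reals. *)
Lemma nonint_nbhs (r : R) : r \isn't a Num.int ->
  exists2 e : R, 0 < e & forall s, `|r - s| < e -> s \isn't a Num.int.
Proof.
move=> rN.
have [] : (Num.floor r)%:~R < r /\ r < (Num.floor r + 1)%:~R.
  split; last exact: floorD1_gt.
  rewrite lt_neqAle ge_floor andbT; apply: contra rN => /eqP <-; exact: intr_int.
set a := Num.floor r => ar ra.
(* The distance from [r] to the nearest integer. *)
exists (Num.min (r - a%:~R) ((a + 1)%:~R - r)).
  by rewrite lt_min !subr_gt0 ar.
move=> s; rewrite lt_min !ltr_norml => /andP[/andP[h1 h2] /andP[h3 h4]].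
apply/negP => /intrP[z sz]; move: h1 h2 h3 h4; rewrite sz => h1 h2 h3 h4.
have : (a%:~R : R) < z%:~R by lra.
have : (z%:~R : R) < (a + 1)%:~R by lra.
by rewrite !ltr_int; lia.
Qed.

End IntegralVectors.

Lemma card_fset_set_range (I : finType) (T : choiceType) (f : I -> T) :
  injective f -> finite_set (range f) /\ #|` fset_set (range f)|%fset = #|I|.
Proof.
move=> f_inj; have -> : range f = [set` [fset x in codom f]%fset].
  apply/seteqP; split=> [_ [i _ <-]|x] /=; rewrite in_fset; first exact: codom_f.
  by move=> /codomP[i ->]; exists i.
split; first exact: finite_fset.
rewrite set_fsetK card_fseq undup_id ?size_codom //.
by rewrite map_inj_uniq ?enum_uniq.
Qed.

Section Torus.
Variables (R : realType) (d : nat).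
Local Notation torus := (torus R d).
Local Open Scope quotient_scope.
Implicit Types (A : 'M[int]_d) (v w : 'cV[R]_d).

Definition to_torus (v : 'cV[R]_d) : torus := \pi_torus v.

Lemma to_torus_repr (x : torus) : to_torus (repr x) = x.
Proof. exact: (@reprK _ torus). Qed.

Lemma to_torus_eqP v w : to_torus v = to_torus w <-> int_vec (v - w).
Proof.
split=> [/(@eqquotP _ (lattice_equiv R d) {eq_quot lattice_equiv R d})/forallP e i|e].
  by have := e i; rewrite !mxE.
apply/(@eqquotP _ (lattice_equiv R d) {eq_quot lattice_equiv R d})/forallP => i.
by have := e i; rewrite !mxE.
Qed.

Lemma fixed_to_torus A v :
  fixed_points R A (to_torus v) <-> int_vec (map_mx intr (A - 1%:M) *m v).
Proof.
rewrite /fixed_points /= /to_torus torus_map_pi -[_ = _]/(to_torus _ = to_torus _).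
by rewrite to_torus_eqP map_mxB map_mx1 mulmxBl mul1mx.
Qed.

Lemma nbhs_to_torus v (V : set torus) : nbhs (to_torus v) V ->
  exists2 e : R, 0 < e &
    forall w, (forall i, `|v i ord0 - w i ord0| < e) -> V (to_torus w).
Proof.
have /(_ v V) cont := @pi_continuous _ {eq_quot lattice_equiv R d}.
move=> /cont /nbhs_ballP[e /= e0 eV]; exists e => // w vw.
apply: eV; split=> // i j; rewrite (ord1 j); exact: vw.
Qed.

(** Along a coordinate where two vectors differ by a non-integer, all vectors near
    the first one still do. *)
Lemma accessible_torus : accessible_space torus.
Proof.
move=> x y xy; exists (~` [set y]); split; last 2 first.
- by rewrite inE /=; move/eqP: xy.
- by rewrite setCK inE.
rewrite /open /= /quotient_open openE => v /= vy.
have : ~ int_vec (v - repr y).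
  by move=> /to_torus_eqP; rewrite to_torus_repr.
move=> /existsNP[i /negP]; rewrite !mxE => /nonint_nbhs[e e0 eN].
apply/nbhs_ballP; exists e => //= w [_ vw] /= wy.
have /to_torus_eqP/(_ i) : to_torus w = to_torus (repr y) by rewrite to_torus_repr.
rewrite !mxE; apply/negP/eN; rewrite opprB addrA subrK.
exact: vw.
Qed.

Lemma isolated_finite (F : set torus) : finite_set F -> isolated F = F.
Proof.
move=> finF; apply/seteqP; split=> [|x Fx]; first exact: isolatedS.
split; first exact: mem_set.
have cl : closed (F `\ x).
  by have /accessible_finite_set_closed := accessible_torus; apply; apply: finite_setD.
exists (~` (F `\ x)).
  by apply: open_nbhs_nbhs; split; [exact: closed_openC|move=> [_ /(_ erefl)]].
apply/seteqP; split=> [y [/= h Fy]|_ -> /=]; last by split=> // -[_ /(_ erefl)].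
by apply: contrapT => yx; apply: h.
Qed.

(** A real kernel vector [w] of [A - 1] gives fixed points [v + t w] for all
    real [t]; for small [t > 0] they differ from the class of [v]. *)
Lemma isolated_fixed_det0 A :
  \det (A - 1%:M) = 0 -> isolated (fixed_points R A) = set0.
Proof.
move=> detA0; apply/seteqP; split=> // x [/set_mem + [V xV VF]].
rewrite -(to_torus_repr x) in xV VF *; set v := repr x in xV VF *.
move=> /fixed_to_torus vfix.
have /det0P[u u0 uA] : \det (map_mx intr (A - 1%:M) : 'M[R]_d)^T == 0.
  by rewrite det_tr det_map_mx detA0.
pose w := u^T; have Bw : map_mx intr (A - 1%:M) *m w = 0.
  by apply: trmx_inj; rewrite trmx_mul trmxK uA trmx0.
have [i wi0] : exists i, w i ord0 != 0.
  by have /rV0Pn[i ui] := u0; exists i; rewrite mxE.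
have [e e0 eV] := nbhs_to_torus xV.
pose W := 1 + \sum_j `|w j ord0|.
have wW j : `|w j ord0| < W.
  rewrite /W (bigD1 j) //= addrCA ltrDl ltr_pwDl // sumr_ge0 //.
have W0 : 0 < W by rewrite (le_lt_trans _ (wW i)).
(* Then every [t * w j] is smaller than [e], so that the point stays in the
   neighbourhood, and smaller than [1], so that [t * w i] is not an integer. *)
pose t := Num.min e 1 / W.
have t0 : 0 < t by rewrite divr_gt0 // lt_min e0 ltr01.
have tw j : `|t * w j ord0| < Num.min e 1.
  rewrite normrM (gtr0_norm t0) /t mulrAC -mulrA gtr_pMr ?lt_min ?e0 ?ltr01 //.
  by rewrite ltr_pdivrMr // mul1r.
have : (V `&` fixed_points R A) (to_torus (v + t *: w)).
  split.
    apply: eV => j; rewrite !mxE opprD addNKr normrN.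
    by have := tw j; rewrite mxE lt_min => /andP[].
  by apply/fixed_to_torus; rewrite mulmxDr -scalemxAr Bw scaler0 addr0.
rewrite VF /= => /to_torus_eqP/(_ i); rewrite addrC addKr mxE => /intrP[z zE].
have := tw i; rewrite zE lt_min => /andP[_].
rewrite -intr_norm -[1]/(1%:~R) ltr_int => z1.
have z0 : z = 0 by lia.
by move/eqP: zE; rewrite z0 mulf_eq0 (gt_eqF t0) (negPf wi0).
Qed.

(** The Smith normal form solved for the diagonal matrix; the signs of the
    diagonal entries are absorbed into the left factor. *)
Lemma smith_normal_form_det (B : 'M[int]_d) : \det B != 0 ->
  exists (P Q : 'M[int]_d) (n : 'I_d -> nat),
    [/\ P \in unitmx, Q \in unitmx, forall i, (0 < n i)%N,
        P *m B *m Q = diag_mx (\row_i (n i)%:Z)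
      & `|\det B| = (\prod_i n i)%N%:Z].
Proof.
move=> B0; have [L Lu [N Nu [dd _ BE]]] := int_Smith_normal_form B.
pose D : 'M[int]_d := diag_mx (\row_i dd`_i).
have {}BE : B = L *m D *m N.
  rewrite BE; congr (_ *m _ *m _); apply/matrixP => i j; rewrite !mxE.
  by case: eqP => [/val_inj ->|ij]; rewrite ?eqxx ?mulr1n // -val_eqE; case: eqP.
have dd0 (i : 'I_d) : dd`_i != 0.
  have : \det D != 0 by apply: contraNneq B0 => D0; rewrite BE !det_mulmx D0 mulr0 mul0r.
  by rewrite det_diag => /prodf_neq0/(_ i isT); rewrite mxE.
pose S : 'M[int]_d := diag_mx (\row_i Num.sg dd`_i).
have Su : S \in unitmx.
  rewrite unitmxE det_diag; apply: unitr_prod => j _; rewrite mxE.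
  by case: (ltgtP dd`_j 0) (dd0 j) => [/ltr0_sg ->|/gtr0_sg ->|].
pose n (i : 'I_d) := `|(dd`_i)%R|%N.
have PBQ : (S *m invmx L) *m B *m invmx N = diag_mx (\row_i (n i)%:Z).
  rewrite BE !mulmxA mulmxK // mulmxKV // mulmx_diag; congr diag_mx.
  by apply/rowP => i; rewrite !mxE abszE normrEsg.
have Pu : S *m invmx L \in unitmx by rewrite unitmx_mul Su unitmx_inv.
exists (S *m invmx L), (invmx N), n; split; rewrite ?unitmx_inv //.
  by move=> i; rewrite /n absz_gt0.
have unit1 (X : 'M[int]_d) : X \in unitmx -> `|\det X| = 1.
  by rewrite unitmxE => /orP[] /eqP ->.
have := congr1 (fun X => `|\det X|) PBQ.
rewrite 2!det_mulmx !normrM (unit1 _ Pu) (unit1 (invmx N)) ?unitmx_inv // mul1r mulr1 => ->.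
rewrite det_diag ger0_norm; last by apply: prodr_ge0 => i _; rewrite mxE.
by rewrite -natz natr_prod; apply: eq_bigr => i _; rewrite mxE natz.
Qed.

(** In the coordinates [y] with [v = Q y], which are well defined modulo the
    lattice since [Q] is unimodular, being fixed means that each [n i * y_i] is
    an integer: the fixed points are the [y_i = k_i / n i] with [k_i < n i]. *)
Lemma fixed_points_finite_card A : \det (A - 1%:M) != 0 ->
  finite_set (fixed_points R A) /\
  (#|` fset_set (fixed_points R A)|%fset)%:Z = `|\det (A - 1%:M)|.
Proof.
move=> /smith_normal_form_det[P [Q [n [Pu Qu n0 PBQ ->]]]].
set B := A - 1%:M in PBQ *.
pose T := {dffun forall i : 'I_d, 'I_(n i)}.
pose u (k : T) : 'cV[R]_d := \col_i ((k i)%:R / (n i)%:R).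
pose phi (k : T) := to_torus (map_mx intr Q *m u k).
have nR i : (n i)%:R != 0 :> R by rewrite pnatr_eq0 -lt0n.
have fixE y : fixed_points R A (to_torus (map_mx intr Q *m y)) <->
    forall i, (n i)%:R * y i ord0 \is a Num.int.
  have e i : (map_mx intr P *m (map_mx intr B *m (map_mx intr Q *m y))) i ord0 =
      (n i)%:R * y i ord0.
    rewrite !mulmxA -!map_mxM PBQ mxE (bigD1 i) //= big1 => [|j ji].
      by rewrite !mxE eqxx addr0.
    by rewrite !mxE eq_sym (negPf ji) mul0r.
  split=> [/fixed_to_torus/(int_vec_mulmx P) h i|h]; first by rewrite -e; exact: h.
  by apply/fixed_to_torus/(int_vec_unimodular Pu) => i; rewrite e.
have eqE y y' :
    to_torus (map_mx intr Q *m y) = to_torus (map_mx intr Q *m y') <->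
    int_vec (y - y').
  rewrite to_torus_eqP -mulmxBr; split; [exact: int_vec_unimodular|exact: int_vec_mulmx].
have phi_inj : injective phi.
  move=> k k' /eqE kk'; apply/ffunP => i; apply/val_inj => /=.
  have := kk' i; rewrite !mxE -mulrBl => /intrP[z /(canRL (divfK (nR i)))].
  rewrite !pmulrn -intrB -intrM => /intr_inj kzn.
  have := ltn_ord (k i); have := ltn_ord (k' i); move: kzn.
  set a := nat_of_ord (k i); set b := nat_of_ord (k' i); move=> kzn bn an.
  suff z0 : z = 0 by move: kzn; rewrite z0; lia.
  by nia.
have fix_phi : fixed_points R A = range phi.
  apply/seteqP; split=> [x|_ [k _ <-]]; last first.
    by apply/fixE => i; rewrite mxE mulrC divfK // natr_int.
  have -> : x = to_torus (map_mx intr Q *m (map_mx intr (invmx Q) *m repr x)).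
    by rewrite mulmxA -map_mxM mulmxV // map_mx1 mul1mx to_torus_repr.
  move: (map_mx intr (invmx Q) *m repr x) => y /fixE yint.
  (* The integers [n i * y_i], to be reduced modulo [n i]. *)
  have c i : {z : int | (n i)%:R * y i ord0 = z%:~R}.
    by have /intrP/cid := yint i.
  have kn i : (`|(sval (c i) %% n i)%Z| < n i)%N.
    have nz : (n i)%:Z != 0 by rewrite -lt0n.
    have := modz_ge0 (sval (c i)) nz; have := ltz_mod (sval (c i)) nz; lia.
  exists [ffun i => Ordinal (kn i)] => //; apply/esym/eqE => i.
  rewrite !mxE ffunE /= natr_absz.
  have nz : (n i)%:Z != 0 by rewrite -lt0n.
  rewrite ger0_norm ?modz_ge0 //; case: (c i) => /= z zE.
  have -> : y i ord0 = z%:~R / (n i)%:R by rewrite -zE mulrAC mulfV ?mul1r.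
  rewrite {1}(divz_eq z (n i)) -mulrBl -intrB addrK intrM mulfK ?intr_int //.
  exact: nR.
rewrite fix_phi; have [phi_fin ->] := card_fset_set_range phi_inj; split=> //.
rewrite card_dep_ffun foldrE big_image /=; congr Posz; apply: eq_bigr => i _.
by rewrite card_ord.
Qed.

End Torus.

(** * Conclusion *)

Section Conclusion.
Variables (R : realType) (d : nat).
Implicit Types A M : 'M[int]_d.

Lemma isolated_fixed_points_card A :
  finite_set (isolated (fixed_points R A)) /\
  (#|` fset_set (isolated (fixed_points R A))|%fset)%:Z = `|\det (1%:M - A)|.
Proof.
have -> : `|\det (1%:M - A)| = `|\det (A - 1%:M)|.
  by rewrite -opprB det_oppmx normrM normrX normrN1 expr1n mul1r.
have [detA0|detA0] := eqVneq (\det (A - 1%:M)) 0.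
  by rewrite (isolated_fixed_det0 R detA0) detA0 normr0 fset_set0 cardfs0.
have [fin <-] := fixed_points_finite_card R detA0.
by rewrite (isolated_finite fin).
Qed.

(** If [M ^+ m - 1] is singular, so is one of its factors [M - z] over the [m]-th
    roots of unity [z]. *)
Lemma det_1subX_neq0 M m : (0 < m)%N ->
    (forall x : R[i], complex_eigenvalue M x -> ~~ m.-unity_root x) ->
  \det (M ^+ m - 1%:M) != 0.
Proof.
case: d M => [|d'] M m0 noroot; first by rewrite det_mx00.
have [r rE] := closed_field_poly_normal ('X^m - 1 : {poly R[i]}).
have {}rE : 'X^m - 1 = \prod_(z <- r) ('X - z%:P) :> {poly R[i]}.
  by rewrite rE (monicP (monicXnsubC _ m0)) scale1r.
rewrite -(@intr_eq0 R[i]) -det_map_mx map_mxB map_mx1 map_mx_exp (det_prod_roots _ rE).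
rewrite prodf_seq_neq0; apply/allP => z zr /=.
apply: contraT; rewrite negbK => detz.
have : complex_eigenvalue M z
  by rewrite /complex_eigenvalue eigenvalue_root_char rootE horner_char_poly -opprB det_oppmx
    (eqP detz) mulr0.
by move=> /noroot; rewrite /root_of_unity rE root_prod_XsubC zr.
Qed.

Lemma complex_eigenvalue_int M (a : int) :
  complex_eigenvalue M (a%:~R : R[i]) = (\det (a%:M - M) == 0).
Proof.
rewrite /complex_eigenvalue eigenvalue_root_char rootE horner_char_poly.
by rewrite -(map_scalar_mx intr) -map_mxB det_map_mx intr_eq0.
Qed.

End Conclusion.

Theorem theorem1 (R : realType) (d : nat) (hd : (0 < d)%N) (M : 'M[int]_d) :
  (forall m : nat, (0 < m)%N ->
     finite_set (isolated (fixed_points R (M ^+ m)))) /\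
  (exists (sigma tau : nat) (Q : {poly int}),
     pm1_factorization M sigma tau Q) /\
  (forall (sigma tau : nat) (Q : {poly int}),
     pm1_factorization M sigma tau Q ->
     let delta := delta_sign M tau in
     let eps := eps_sign M sigma tau in
     [/\ delta = 1 \/ delta = -1,
         eps = 1 \/ eps = -1
       & expansion_at0 (zeta_ratfun M delta eps) (zeta R M)]) /\
  (~~ complex_eigenvalue M (1 : R[i]) ->
   ~~ complex_eigenvalue M (-1 : R[i]) ->
     let delta := Num.sg (\det (1%:M + M)) in
     let eps := delta * Num.sg (\det (1%:M - M)) in
     [/\ delta = 1 \/ delta = -1,
         eps = 1 \/ eps = -1
       & expansion_at0 (zeta_ratfun M delta eps) (zeta R M)]) /\
  (exists f : {fraction {poly rat}}, expansion_at0 f (zeta R M)) /\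
  ((forall x : R[i], complex_eigenvalue M x ->
      forall n : nat, (0 < n)%N -> ~~ n.-unity_root x) ->
   forall m : nat, (0 < m)%N ->
     [/\ fixed_points R (M ^+ m) `<=` isolated (fixed_points R (M ^+ m)),
         finite_set (fixed_points R (M ^+ m))
       & num_isolated_fix R M m = #|` fset_set (fixed_points R (M ^+ m)) |]).
Proof.
have zetaE sigma tau Q : pm1_factorization M sigma tau Q ->
    let delta := delta_sign M tau in
    let eps := eps_sign M sigma tau in
    [/\ delta = 1 \/ delta = -1,
        eps = 1 \/ eps = -1
      & expansion_at0 (zeta_ratfun M delta eps) (zeta R M)].
  move=> /delta_eps_signP[delta1 eps1 epsE deltaE]; split=> //.
  apply: expansion_zeta_ratfun => // m m0.
  have [_ ->] := isolated_fixed_points_card R (M ^+ m).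
  case: d hd M delta1 eps1 epsE deltaE => // d' _ M' delta1 _ epsE deltaE.
  exact: abs_det_1subX.
have [sigma [tau [Q factM]]] := pm1_factorization_exists M.
split; first by move=> m _; have [] := isolated_fixed_points_card R (M ^+ m).
split; first by exists sigma, tau, Q.
split; first exact: zetaE.
split.
  move=> eig1 eigN1.
  have {eig1} det1 : \det (1%:M - M) != 0.
    have := complex_eigenvalue_int R M 1; rewrite mulr1z => <-; exact: eig1.
  have {eigN1} detN1 : \det ((-1)%:M - M) != 0.
    have := complex_eigenvalue_int R M (-1); rewrite mulrN1z => <-; exact: eigN1.
  (* When neither [1] nor [-1] is an eigenvalue, the factorization is trivial and
     the signs are the unadorned ones. *)
  have fact0 : pm1_factorization M 0 0 (char_poly M).
    by split; rewrite ?expr0 ?mul1r // horner_char_poly.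
  have {}detN1 : \det (1%:M + M) != 0.
    move: detN1; rewrite (_ : (-1)%:M - M = - (1%:M + M)); last by rewrite opprD raddfN.
    by rewrite det_oppmx mulf_eq0 signr_eq0.
  move=> delta eps.
  have [_ _ epsE deltaE] := delta_eps_signP fact0.
  have := zetaE _ _ _ fact0.
  by rewrite /= (epsE det1) (deltaE detN1).
split; first by have [_ _ h] := zetaE _ _ _ factM; eexists; exact: h.
move=> noroot m m0.
have detN0 : \det (M ^+ m - 1%:M) != 0 by apply: (@det_1subX_neq0 R) => // x /noroot; apply.
have [fin _] := fixed_points_finite_card R detN0.
by rewrite /num_isolated_fix (isolated_finite fin); split.
Qed.
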